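(* Assume $\mu_w(x,y)$ is a smooth function of $w$ and that $\mathbb{E}_{(x,y)\sim\mathcal D}\|\nabla_w\mu_w(x,y)\|<\infty$. Assume moreover that the functions $\mu_w(x,y)$ are continuous in $w$ and that the loss-perturbed maximal argument $y^*_{w+\frac1n u}(\epsilon)$ is unique for any $u$ and $n$. Then the prediction generating function $$G(w,\epsilon)=\mathbb{E}_{(x,y)\sim\mathcal D}\Big[\max_{\hat y\in Y}\{\mu_w(x,\hat y)+\epsilon\,\ell(y,\hat y)\}\Big]$$ is differentiable and $$\frac{\partial G(w,\epsilon)}{\partial\epsilon}=\mathbb{E}_{(x,y)\sim\mathcal D}\big[\ell(y,y^*_w)\big],\qquad \frac{\partial G(w,\epsilon)}{\partial w}=\mathbb{E}_{(x,y)\sim\mathcal D}\big[\nabla_w\mu_w(x,y^*_w(\epsilon))\big].$$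
   Context: $X$ is a set of data instances, $Y$ is a finite (discrete) set of structured labels, and $\mathcal D$ is a probability distribution over pairs $(x,y)\in X\times Y$. $w$ is a real parameter vector, $\mu_w(x,y)\in\mathbb R$ is a score function parametrized by $w$, $\ell(\cdot,\cdot)$ is a real-valued loss function on pairs of labels, and $\epsilon\in\mathbb R$. ''Smooth'' means infinitely differentiable. For a pair $(x,y)$, the predicted label is $y^*_w=\arg\max_{\hat y\in Y}\mu_w(x,\hat y)$, and the loss-perturbed maximal argument is $y^*_w(\epsilon)=\arg\max_{\hat y\in Y}\{\mu_w(x,\hat y)+\epsilon\,\ell(y,\hat y)\}$ (the dependence on $(x,y)$ is suppressed in the notation). Here $u$ ranges over directions (vectors of the same dimension as $w$) and $n$ over positive integers. In $\nabla_w\mu_w(x,y^*_w(\epsilon))$ the gradient is that of $w\mapsto\mu_w(x,\hat y)$ evaluated at $\hat y=y^*_w(\epsilon)$.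
   Formalization: Added: near w, the gradients of the scores of all candidate labels are bounded by one D-integrable function, and the expectation defining G(w,ε) is finite. The ε-derivative is E[ℓ(y,y*_w(ε))] for general ε; the printed E[ℓ(y,y*_w)] is claimed only at ε=0. *)

(* Defs.v *)
From HB Require Import structures.
From mathcomp Require Import all_boot all_order all_algebra.
From mathcomp Require Import all_classical all_reals all_analysis.

Set Implicit Arguments.
Unset Strict Implicit.
Unset Printing Implicit Defensive.

Import Order.TTheory GRing.Theory Num.Theory numFieldNormedType.Exports.

Local Open Scope classical_set_scope.
Local Open Scope ring_scope.

(* That the sigma-algebra is the discrete one is not part of the structure. *)
#[short(type="finMeasurableType")]
HB.structure Definition FinMeasurable d := {T of Finite T & Measurable d T}.

Section calculus.
Variables (R : realType) (d : nat).
Implicit Types (f : 'rV[R]_d -> R) (w : 'rV[R]_d).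

Definition grad f w : 'rV[R]_d := \row_(i < d) 'D_(delta_mx 0 i) f w.

Fixpoint C_times (k : nat) f : Prop :=
  if k is k'.+1 then
    (forall w, differentiable f w) /\ forall u, C_times k' (fun w => 'D_u f w)
  else continuous f.

Definition smooth f := forall k, C_times k f.

End calculus.

Definition unique_argmax (R : realType) (T : Type) (f : T -> R) : Prop :=
  exists! y, forall y', f y' <= f y.

Section prediction.
Variables (R : realType) (d : nat) (dX dY : measure_display).
Variables (X : measurableType dX) (Y : finMeasurableType dY).
Variables (mu : 'rV[R]_d -> X -> Y -> R) (l : Y -> Y -> R).
Implicit Types (w : 'rV[R]_d) (eps : R) (z : X * Y).

Definition perturbed_score w eps z (yhat : Y) : R :=
  mu w z.1 yhat + eps * l z.2 yhat.

(* In the next three definitions the data label z.2 only witnesses that Y is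
   inhabited; the result is a maximum (resp. a maximizer) over all of Y. *)
Definition max_score w eps z : R :=
  \big[Num.max/perturbed_score w eps z z.2]_(yhat : Y)
    perturbed_score w eps z yhat.

Definition predicted_label w z : Y :=
  [arg max_(yhat > z.2) mu w z.1 yhat]%O.

Definition perturbed_label w eps z : Y :=
  [arg max_(yhat > z.2) perturbed_score w eps z yhat]%O.

Definition prediction_generating (D : probability (X * Y)%type R) w eps : R :=
  fine 'E_D[max_score w eps].

End prediction.

(* Main.v *)
(* Where the maximizer m of the perturbed score at (w, eps) is unique, it stays
   a maximizer nearby, so that the max score coincides there with the perturbed
   score of m and is differentiable at (w, eps); its differential sends (h, t)
   to D_h (mu _ x m) w + t * l y m.  By the mean value theorem and the
   domination of the gradients its increments are at most k z * |(h, t)| for an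
   integrable k, so dominated convergence, along a sequence that would violate
   the first-order expansion of G, moves the differential under the expectation.
   The two partial derivatives are its values at (0, 1) and (delta_i, 0). *)
Require Import Defs.
From HB Require Import structures.
From mathcomp Require Import all_boot all_order all_algebra.
From mathcomp Require Import all_classical all_reals all_analysis.
From mathcomp Require Import measurable_realfun ring lra.

Set Implicit Arguments.
Unset Strict Implicit.
Unset Printing Implicit Defensive.

Import Order.TTheory GRing.Theory Num.Theory numFieldNormedType.Exports.

Local Open Scope classical_set_scope.
Local Open Scope ring_scope.

(** * Differentiability as a first-order expansion with explicit error *)

Section Differentiability.
Variables (R : realType) (V W : normedModType R).
Implicit Types (f : V -> W) (x : V).

Lemma differentiable_dist_le f x (eta : R) : differentiable f x -> 0 < eta ->
  \forall h \near (0 : V), `|f (h + x) - f x - 'd f x h| <= eta * `|h|.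
Proof.
move=> /diff_locallyP[_ /eqaddoP fo] eta0.
by have := fo _ eta0; apply: filterS => h /=; rewrite !fctE opprD addrA.
Qed.

(** The bound by [K] makes the linear map [df] continuous, which linearity alone does not give in a
    general normed space; uniqueness of the differential then identifies it. *)
Lemma dist_le_differentiable f x (df : V -> W) (K : R) :
  linear df -> (forall h, `|df h| <= K * `|h|) ->
  (forall eta : R, 0 < eta ->
    \forall h \near (0 : V), `|f (h + x) - f x - df h| <= eta * `|h|) ->
  differentiable f x /\ 'd f x = df :> (V -> W).
Proof.
move=> df_lin df_le df_o.
pose dfL : {linear V -> W} := HB.pack df (GRing.isLinear.Build R V W *:%R df df_lin).
have df_cont : continuous dfL.
  apply/linear_bounded_continuous/linear_boundedP.
  near=> r => h; apply: le_trans (df_le h) _.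
  by rewrite ler_wpM2r//; near: r; apply: nbhs_pinfty_ge; rewrite num_real.
have fo : f \o shift x = cst (f x) + dfL +o_0 id.
  by apply/eqaddoP => eta /df_o; apply: filterS => h /=; rewrite !fctE opprD addrA.
have dE := diff_unique df_cont fo.
by split; [apply/diff_locallyP; rewrite dE|rewrite dE].
Unshelve. all: by end_near. Qed.

End Differentiability.

(** * Differentiation under the integral sign *)

Section DifferentiationUnderIntegral.
Variables (R : realType) (V : normedModType R).
Variables (d0 : measure_display) (T : measurableType d0).
Variable P : {measure set T -> \bar R}.
Variables (F : V -> T -> R) (A : V -> T -> R) (p : V) (k : T -> R).
Hypothesis F_meas : forall q, measurable_fun setT (F q).
Hypothesis A_meas : forall h, measurable_fun setT (A h).
Hypothesis F_int : P.-integrable setT (EFin \o F p).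
Hypothesis k_int : P.-integrable setT (EFin \o k).
Hypothesis A_lin : forall z, linear (A ^~ z).
Hypothesis A_le : forall h z, `|A h z| <= k z * `|h|.
Hypothesis F_lip :
  \forall h \near (0 : V), forall z, `|F (h + p) z - F p z| <= k z * `|h|.
Hypothesis F_diff : {ae P, forall z, forall eta : R, 0 < eta ->
  \forall h \near (0 : V), `|F (h + p) z - F p z - A h z| <= eta * `|h|}.

Let integrable_le_scale (f : T -> R) (c : R) : measurable_fun setT f ->
  (forall z, `|f z| <= k z * c) -> P.-integrable setT (EFin \o f).
Proof.
move=> f_meas f_le.
apply: (@le_integrable _ _ _ _ _ measurableT _ (fun z => c%:E * (EFin \o k) z)%E).
- exact/measurable_EFinP.
- move=> z _ /=; rewrite lee_fin; apply: le_trans (f_le z) _.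
  by rewrite mulrC ler_norm.
- exact: integrableZl.
Qed.

Lemma integrable_linear_le h : P.-integrable setT (EFin \o A h).
Proof. by apply: (integrable_le_scale (c := `|h|)) => // z; exact: A_le. Qed.

(** Dominated convergence applied to the normalized first-order remainders: they tend to 0 almost
    everywhere by [F_diff], at a rate that may depend on [z], while [k] dominates uniformly. *)
Let quotient_cvg0 (h_ : V^nat) :
  (forall n, `|h_ n| < n.+1%:R^-1) -> (forall n, h_ n != 0) ->
  (forall n z, `|F (h_ n + p) z - F p z| <= k z * `|h_ n|) ->
  (fun n => \int[P]_z (`|h_ n|^-1 * (F (h_ n + p) z - F p z - A (h_ n) z)))
    @ \oo --> (0 : R).
Proof.
move=> h_small h_neq0 h_lip.
have h_cvg : h_ @ \oo --> (0 : V).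
  apply/cvgr0Pnorm_lt => e e0; near=> n; apply: lt_trans (h_small n) _.
  by near: n; exact: (near_infty_natSinv_lt (PosNum e0)).
pose q n z := `|h_ n|^-1 * (F (h_ n + p) z - F p z - A (h_ n) z).
have hgt n : 0 < `|h_ n| by rewrite normr_gt0.
have q_meas n : measurable_fun setT (q n).
  apply: measurable_funM => //; apply: measurable_funB => //.
  exact: measurable_funB.
(* One [k z] pays for the increment of [F], the other for [A]. *)
have q_le n z : `|q n z| <= k z * 2.
  rewrite /q normrM normfV normr_id mulrC ler_pdivrMr// mulrAC.
  rewrite mulr_natr mulr2n.
  by apply: le_trans (ler_normB _ _) _; rewrite lerD.
have q_cvg : {ae P, forall z, setT z ->
    (fun n => (EFin \o q n) z) @ \oo --> cst (0%E : \bar R) z}.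
  apply: filterS F_diff => z Fz _; apply: cvg_EFin; first exact: nearW.
  apply/cvgr0Pnorm_le => e e0.
  have : \forall n \near \oo,
    `|F (h_ n + p) z - F p z - A (h_ n) z| <= e * `|h_ n|.
    exact: h_cvg (Fz _ e0).
  apply: filterS => n.
  by rewrite /= /q normrM normfV normr_id ler_pdivrMl// mulrC.
have q_dom : {ae P, forall z n, setT z ->
    (`|(EFin \o q n) z| <= 2%:E * (EFin \o k) z)%E}.
  by apply: aeW => z n _ /=; rewrite lee_fin mulrC.
have [_ _] := dominated_convergence measurableT
  (fun n => proj2 (measurable_EFinP _ _) (q_meas n)) (measurable_cst _)
  q_cvg (integrableZl measurableT 2 k_int) q_dom.
by rewrite integral0 => /fine_cvg.
Unshelve. all: by end_near. Qed.

Let difference_le (eta : R) : 0 < eta ->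
  \forall h \near (0 : V),
    `|\int[P]_z F (h + p) z - \int[P]_z F p z - \int[P]_z A h z| <= eta * `|h|.
Proof.
move=> eta0; apply: contrapT => diff_gt.
(* Dominated convergence needs a sequence, so the failure of the estimate is turned into
   counterexamples [h_ n] tending to 0 inside the neighbourhood of [F_lip]. *)
have /choice[h_ h_spec] : forall n : nat, exists h : V,
    [/\ `|h| < n.+1%:R^-1,
        forall z, `|F (h + p) z - F p z| <= k z * `|h| &
        ~ `|\int[P]_z F (h + p) z - \int[P]_z F p z - \int[P]_z A h z|
          <= eta * `|h| ].
  move=> n; apply: contrapT => /forallNP h_none; apply: diff_gt.
  have h_ball : \forall h \near (0 : V), `|h| < n.+1%:R^-1.
    by apply/nbhs_norm0P; exists n.+1%:R^-1 => //=; rewrite invr_gt0.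
  apply: filterS2 h_ball F_lip => h h_lt h_lip.
  by apply: contrapT => h_gt; apply: (h_none h).
have A0 z : A 0 z = 0.
  by apply/eqP; rewrite -normr_le0 -[leRHS](mulr0 (k z)) -(normr0 V) A_le.
(* At 0 both sides of the estimate vanish, so 0 is never a counterexample. *)
have h_neq0 n : h_ n != 0.
  apply/eqP => h0; have [_ _ h_gt] := h_spec n; apply: h_gt.
  rewrite h0 add0r subrr sub0r normrN normr0 mulr0.
  by under eq_Rintegral do rewrite A0; rewrite Rintegral_cst// mul0r normr0.
have hgt n : 0 < `|h_ n| by rewrite normr_gt0.
have Fh_int n : P.-integrable setT (EFin \o (fun z => F (h_ n + p) z - F p z)).
  apply: (integrable_le_scale (c := `|h_ n|)) => //; first exact: measurable_funB.
  by case: (h_spec n).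
have /cvgr0Pnorm_lt/(_ _ eta0)[N _ /(_ N (leqnn N))] := quotient_cvg0
  (fun n => let: And3 h_lt _ _ := h_spec n in h_lt) h_neq0
  (fun n => let: And3 _ h_lip _ := h_spec n in h_lip).
have [_ _ h_gt] := h_spec N; rewrite /= RintegralZl//; last first.
  exact: (integrableB measurableT (Fh_int N) (integrable_linear_le _)).
rewrite RintegralB//; last exact: integrable_linear_le.
(* Integrability is assumed at [p] only; the dominated increment carries it to the shifted point. *)
have F_shift_int : P.-integrable setT (EFin \o F (h_ N + p)).
  have := integrableD measurableT (Fh_int N) F_int.
  by apply: eq_integrable => // z _ /=; rewrite -EFinD subrK.
rewrite RintegralB// normrM normfV normr_id ltr_pdivrMl// mulrC.
by move=> /ltW /h_gt.
Qed.

Lemma differentiable_Rintegral :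
  differentiable (fun q => \int[P]_z F q z) p /\
  'd (fun q => \int[P]_z F q z) p = (fun h => \int[P]_z A h z) :> (V -> R).
Proof.
apply: (dist_le_differentiable (K := \int[P]_z k z)) => //.
- move=> a u v; under eq_Rintegral do rewrite A_lin.
  rewrite RintegralD//; last 2 first.
  + exact: (integrableZl measurableT a (integrable_linear_le u)).
  + exact: integrable_linear_le.
  by rewrite RintegralZl//; exact: integrable_linear_le.
- move=> h; apply: le_trans (le_normr_Rintegral _ _) _ => //.
    exact: integrable_linear_le.
  rewrite mulrC -RintegralZl//; apply: le_Rintegral => //.
  + by have /integrable_norm := integrable_linear_le h.
  + exact: (integrableZl measurableT `|h| k_int).
  + by move=> z _; rewrite mulrC.
Qed.

End DifferentiationUnderIntegral.

(** * Measurability of choices from a finite set *)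

Section FiniteSelection.
Variables (R : realType) (d0 : measure_display) (T : measurableType d0).
Variable I : finType.

Lemma measurable_fin_preimage (J : finType) (f : T -> J) (A : set J) :
  (forall j, measurable [set z | f z = j]) -> measurable (f @^-1` A).
Proof.
move=> f_fib; have -> : f @^-1` A = \bigcup_(j in A) [set z | f z = j].
  by apply/seteqP; split => [z Afz|z [j Aj fz]]; [exists (f z)|rewrite /preimage /= fz].
exact: fin_bigcup_measurable.
Qed.

(* The maximizer depends on [z] only through the finitely many truth values of
   the comparisons between scores. *)
Lemma measurable_arg_max (i0 : T -> I) (s : T -> I -> R) :
  (forall i, measurable [set z | i0 z = i]) ->
  (forall i, measurable_fun setT (s ^~ i)) ->
  forall i, measurable [set z | [arg max_(j > i0 z) s z j]%O = i].
Proof.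
move=> i0_fib s_meas i.
pose cmp z : {ffun I * I -> bool} := [ffun q => s z q.1 <= s z q.2].
(* [sel] replays the search behind [arg max] on a table of comparisons [c.1], with [c.2] as its
   default value. *)
pose sel (c : {ffun I * I -> bool} * I) :=
  odflt c.2 [pick j | [forall j', c.1 (j', j)]].
have selE z : [arg max_(j > i0 z) s z j]%O = sel (cmp z, i0 z).
  rewrite /Order.arg_max /extremum /sel /=; congr odflt; apply: eq_pick => j /=.
  by apply: eq_forallb => j'; rewrite ffunE.
have -> : [set z | [arg max_(j > i0 z) s z j]%O = i] =
    (fun z => (cmp z, i0 z)) @^-1` [set c | sel c = i].
  by apply/seteqP; split => z /=; rewrite selE.
apply: measurable_fin_preimage => -[c j].
have -> : [set z | (cmp z, i0 z) = (c, j)] =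
    (\bigcap_(q in setT) (fun z => s z q.1 <= s z q.2) @^-1` [set c q]) `&`
    [set z | i0 z = j].
  apply/seteqP; split => z /=.
    by move=> [<- <-]; split => // q _; rewrite /= ffunE.
  by move=> [cE ->]; congr pair; apply/ffunP => q; rewrite ffunE; exact: cE.
apply: measurableI => //; apply: fin_bigcap_measurable => // q _.
by rewrite -[X in measurable X]setTI; apply: measurable_fun_ler.
Qed.

(** On each of the finitely many fibres of [f] the function is a single [h i], so it is a finite sum
    of the [h i] cut off by indicators. *)
Lemma measurable_fin_select (f : T -> I) (h : I -> T -> R) :
  (forall i, measurable [set z | f z = i]) ->
  (forall i, measurable_fun setT (h i)) ->
  measurable_fun setT (fun z => h (f z) z).
Proof.
move=> f_fib h_meas.
have -> : (fun z => h (f z) z) =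
    (fun z => \sum_(i : I) h i z * \1_[set z' | f z' = i] z).
  apply/funext => z; rewrite (bigD1 (f z))//= big1 => [|i /eqP ni].
    by rewrite indicE mem_set// mulr1 addr0.
  by rewrite indicE memNset ?mulr0// => fi; apply: ni.
by apply: measurable_sum => i; apply: measurable_funM.
Qed.

End FiniteSelection.

(** * Bounds on directional derivatives and increments by the gradient *)

Section GradientBounds.
Variables (R : realType) (d : nat).
Implicit Types (f : 'rV[R]_d -> R) (w h : 'rV[R]_d).

Lemma ler_norm_entry h j : `|h 0 j| <= `|h|.
Proof. by rewrite [leRHS]/Num.norm /= mx_normrE (bigmax_sup (0, j)). Qed.

(** The norm on row vectors is the max norm: expanding [h] in the standard basis gives [d] terms,
    each at most the product of the two norms. *)
Lemma derive_le_grad f w h : differentiable f w ->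
  `|'D_h f w| <= d%:R * `|grad f w| * `|h|.
Proof.
move=> f_diff; rewrite deriveE// {1}[h]row_sum_delta linear_sum /=.
apply: le_trans (ler_norm_sum _ _ _) _.
have -> : d%:R * `|grad f w| * `|h| = \sum_(j < d) `|grad f w| * `|h|.
  by rewrite sumr_const card_ord -mulrA mulr_natl.
apply: ler_sum => j _; rewrite linearZ /= normrZ mulrC ler_pM//.
  by rewrite -deriveE//; have := ler_norm_entry (grad f w) j; rewrite mxE.
exact: ler_norm_entry.
Qed.

Lemma is_derive_line f w h (t : R) : differentiable f (t *: h + w) ->
  is_derive t 1 (fun s : R => f (s *: h + w)) ('D_h f (t *: h + w)).
Proof.
move=> /(diff_derivable (v := h)) f_der.
have lineE : (fun s : R => s^-1 *:
      (((fun s => f (s *: h + w)) \o shift t) (s *: 1) - f (t *: h + w))) =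
    (fun s : R => s^-1 *: ((f \o shift (t *: h + w)) (s *: h) - f (t *: h + w))).
  by apply/funext => s /=; rewrite [s *: 1]mulr1 scalerDl addrA.
by split; rewrite /derivable /derive lineE.
Qed.

(** Mean value theorem on the segment from [w] to [h + w], all of which lies in the ball where the
    gradient is bounded. *)
Lemma dist_le_grad f w h (c r : R) : (forall v, differentiable f v) ->
  (forall v, `|v| < r -> `|grad f (v + w)| <= c) -> `|h| < r ->
  `|f (h + w) - f w| <= d%:R * c * `|h|.
Proof.
move=> f_diff grad_le h_lt.
have line t := is_derive_line (f_diff (t *: h + w)).
have line_cont : {within `[0, 1], continuous (fun s : R => f (s *: h + w))}.
  apply: derivable_within_continuous => t _.
  by case: (line t).
have [t t01 ] := MVT_segment ler01 (fun t _ => line t) line_cont.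
rewrite scale1r scale0r add0r subr0 mulr1 => ->.
apply: le_trans (derive_le_grad _ (f_diff _)) _.
rewrite ler_wpM2r// ler_wpM2l//; apply: grad_le; apply: le_lt_trans h_lt.
move: t01; rewrite in_itv /= => /andP[t0 t1].
by rewrite normrZ ger0_norm// ler_piMl.
Qed.

End GradientBounds.

(** * Partial derivatives and measurability of directional derivatives *)

Lemma derive_fst (R : realType) (U V W : normedModType R) (f : U * V -> W) a b u :
  'D_u (fun a => f (a, b)) a = 'D_(u, 0) f (a, b).
Proof.
have addE (t : R) : t *: (u, 0) + (a, b) = (t *: u + a, b) :> U * V.
  by rewrite [LHS]surjective_pairing /= scaler0 add0r.
by rewrite /derive /=; under [in RHS]eq_fun do rewrite addE.
Qed.

Lemma derive_snd (R : realType) (U V W : normedModType R) (f : U * V -> W) a b v :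
  'D_v (fun b => f (a, b)) b = 'D_(0, v) f (a, b).
Proof.
have addE (t : R) : t *: (0, v) + (a, b) = (a, t *: v + b) :> U * V.
  by rewrite [LHS]surjective_pairing /= scaler0 add0r.
by rewrite /derive /=; under [in RHS]eq_fun do rewrite addE.
Qed.

(** The derivative is the pointwise limit of the measurable difference quotients with step
    [n.+1%:R^-1]. *)
Lemma measurable_derive (R : realType) (V : normedModType R) (d0 : measure_display)
  (T : measurableType d0) (f : V -> T -> R) (a v : V) :
  (forall b, measurable_fun setT (f b)) ->
  (forall x, derivable (f ^~ x) a v) ->
  measurable_fun setT (fun x => 'D_v (f ^~ x) a).
Proof.
move=> f_meas f_der.
pose q (n : nat) x : R := n.+1%:R * (f (n.+1%:R^-1 *: v + a) x - f a x).
suff q_cvg x : q ^~ x @ \oo --> 'D_v (f ^~ x) a.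
  apply: (measurable_fun_cvg _ (fun x _ => q_cvg x)) => n.
  by apply: measurable_funM => //; exact: measurable_funB.
have der_cvg : t^-1 *: (f (t *: v + a) x - f a x) @[t --> (0 : R)^'] -->
    'D_v (f ^~ x) a := f_der x.
have -> : q ^~ x =
    (fun n => (harmonic n)^-1 *: (f (harmonic n *: v + a) x - f a x)).
  by apply/funext => n; rewrite /q /harmonic /= invrK.
apply: ((cvgr_dnbhsP _ _ _).1 der_cvg); split; last exact: cvg_harmonic.
by move=> n; rewrite invr_eq0 pnatr_eq0.
Qed.

(** * The max score: maximizers, measurability and first-order expansion *)

Section Prediction.
Variables (R : realType) (d : nat) (dX dY : measure_display).
Variables (X : measurableType dX) (Y : finMeasurableType dY).
Variables (mu : 'rV[R]_d -> X -> Y -> R) (l : Y -> Y -> R).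
Implicit Types (w : 'rV[R]_d) (e : R) (z : X * Y) (y : Y).

Lemma le_perturbed_label w e z y :
  perturbed_score mu l w e z y <=
  perturbed_score mu l w e z (perturbed_label mu l w e z).
Proof. by rewrite /perturbed_label; case: arg_maxP => //= y0 _; exact. Qed.

Lemma max_scoreE w e z :
  max_score mu l w e z = perturbed_score mu l w e z (perturbed_label mu l w e z).
Proof.
apply/le_anti/andP; split; last exact: le_bigmax.
(* The first goal concerns the initial value of the big maximum, which is itself a score, that of
   [z.2]. *)
by apply/bigmax_leP; split=> [|y _]; exact: le_perturbed_label.
Qed.

(** Each of the two maximizers is tested against the other score, which gives one of the two
    inequalities. *)
Lemma dist_max_score w w' e e' z (c : R) :
  (forall y, `|perturbed_score mu l w e z y - perturbed_score mu l w' e' z y| <= c) ->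
  `|max_score mu l w e z - max_score mu l w' e' z| <= c.
Proof.
rewrite !max_scoreE => score_le; rewrite ler_norml lerBrDl lerBlDl.
set y := perturbed_label _ _ w _ _; set y' := perturbed_label _ _ w' _ _.
apply/andP; split.
- have := score_le y'; rewrite ler_norml => /andP[+ _].
  have := le_perturbed_label w e z y'; rewrite -/y; lra.
- have := score_le y; rewrite ler_norml => /andP[_ +].
  have := le_perturbed_label w' e' z y; rewrite -/y'; lra.
Qed.

(** This lets the derivative in [eps] be expressed through the unperturbed prediction when [eps] is
    0. *)
Lemma perturbed_label0 w z : perturbed_label mu l w 0 z = predicted_label mu w z.
Proof.
rewrite /perturbed_label /predicted_label; congr Order.arg_max.
by apply/funext => y; rewrite /perturbed_score mul0r addr0.
Qed.

Hypothesis Y_discrete : forall A : set Y, measurable A.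
Hypothesis mu_measurable :
  forall w y, measurable_fun setT (fun x => mu w x y).

Lemma measurable_loss y : measurable_fun setT (fun z : X * Y => l z.2 y).
Proof.
exact: (@measurableT_comp _ _ _ _ _ _ (l ^~ y)).
Qed.

Lemma measurable_fst_comp (f : X -> R) :
  measurable_fun setT f -> measurable_fun setT (fun z : X * Y => f z.1).
Proof. by move=> f_meas; exact: (measurableT_comp f_meas measurable_fst). Qed.

Lemma measurable_perturbed_score w e y :
  measurable_fun setT (perturbed_score mu l w e ^~ y).
Proof.
apply: measurable_funD; first exact: (measurable_fst_comp (mu_measurable w y)).
by apply: measurable_funM => //; exact: measurable_loss.
Qed.

Lemma measurable_perturbed_label w e y :
  measurable [set z | perturbed_label mu l w e z = y].
Proof.
apply: (measurable_arg_max (s := perturbed_score mu l w e)) => y0.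
  rewrite -[X in measurable X]setTI.
  exact: (@measurable_snd _ _ X Y measurableT _ (Y_discrete [set y0])).
exact: measurable_perturbed_score.
Qed.

Lemma measurable_max_score w e : measurable_fun setT (max_score mu l w e).
Proof.
rewrite (_ : max_score _ _ _ _ = fun z =>
    perturbed_score mu l w e z (perturbed_label mu l w e z)); last first.
  by apply/funext => z; exact: max_scoreE.
apply: (measurable_fin_select (h := fun y z => perturbed_score mu l w e z y)).
  exact: measurable_perturbed_label.
exact: measurable_perturbed_score.
Qed.

Hypothesis mu_diff : forall x y w, differentiable (fun v => mu v x y) w.

(** The candidate differential of the max score in both variables jointly, with the label frozen at
    its value for [(w, e)]. *)
Definition max_score_diff w e (h : 'rV[R]_d * R) z : R :=
  'D_(h.1) (fun v => mu v z.1 (perturbed_label mu l w e z)) w +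
  h.2 * l z.2 (perturbed_label mu l w e z).

Lemma measurable_max_score_diff w e h :
  measurable_fun setT (max_score_diff w e h).
Proof.
apply: (measurable_fin_select
  (h := fun y z => 'D_(h.1) (fun v => mu v z.1 y) w + h.2 * l z.2 y)).
  exact: measurable_perturbed_label.
move=> y; apply: measurable_funD; last first.
  by apply: measurable_funM => //; exact: measurable_loss.
apply: (@measurable_fst_comp (fun x => 'D_(h.1) (fun v => mu v x y) w)).
by apply: measurable_derive => // x; exact: diff_derivable.
Qed.

Lemma linear_max_score_diff w e z : linear (max_score_diff w e ^~ z).
Proof.
move=> a u v; rewrite /max_score_diff !deriveE// linearP /=.
by rewrite scalerDr -!addrA; congr (_ + _); rewrite addrCA; congr (_ + _);
   rewrite mulrDl scalerAl.
Qed.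

Lemma max_score_diffP w e z :
  unique_argmax (perturbed_score mu l w e z) ->
  forall eta : R, 0 < eta -> \forall h \near (0 : 'rV[R]_d * R),
    `|max_score mu l (h.1 + w) (h.2 + e) z - max_score mu l w e z -
      max_score_diff w e h z| <= eta * `|h|.
Proof.
move=> [y [y_max y_uniq]] eta eta0.
have labelE : perturbed_label mu l w e z = y.
  by apply/esym/y_uniq => y'; exact: le_perturbed_label.
pose score y' (h : 'rV[R]_d * R) := perturbed_score mu l (h.1 + w) (h.2 + e) z y'.
have fst_cvg : fst @ (0 : 'rV[R]_d * R) --> (0 : 'rV[R]_d) by exact: cvg_fst.
have snd_cvg : snd @ (0 : 'rV[R]_d * R) --> (0 : R) by exact: cvg_snd.
have score_cvg y' : score y' @ (0 : 'rV[R]_d * R) -->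
    perturbed_score mu l w e z y'.
  have w_cvg : h.1 + w @[h --> (0 : 'rV[R]_d * R)] --> 0 + w.
    by apply: cvgD => //; exact: cvg_cst.
  have e_cvg : h.2 + e @[h --> (0 : 'rV[R]_d * R)] --> 0 + e.
    by apply: cvgD => //; exact: cvg_cst.
  rewrite add0r in w_cvg; rewrite add0r in e_cvg.
  apply: cvgD; last by apply: cvgM => //; exact: cvg_cst.
  exact: cvg_comp w_cvg (differentiable_continuous (mu_diff z.1 y' w)).
(* By uniqueness every other label trails [y] by a positive gap, which persists nearby by continuity
   of the scores. *)
have score_near y' : \forall h \near (0 : 'rV[R]_d * R), score y' h <= score y h.
  have [->|ny] := eqVneq y' y; first by near=> h.
  have score_lt : perturbed_score mu l w e z y' < perturbed_score mu l w e z y.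
    rewrite ltNge; apply/negP => score_ge; case/eqP: ny.
    by apply/esym/y_uniq => y''; exact: le_trans score_ge.
  have diff_cvg : score y h - score y' h @[h --> (0 : 'rV[R]_d * R)] -->
      perturbed_score mu l w e z y - perturbed_score mu l w e z y'.
    by apply: cvgB; exact: score_cvg.
  have diff_gt0 : 0 < perturbed_score mu l w e z y - perturbed_score mu l w e z y'.
    by rewrite subr_gt0.
  near=> h; rewrite -subr_ge0; near: h.
  exact: (cvgr_ge _ diff_cvg _ diff_gt0).
(* Finiteness of [Y] yields one neighbourhood for all labels. *)
have {}score_near := filter_forall _ score_near.
have mu_o := fst_cvg _ (differentiable_dist_le (mu_diff z.1 y w) eta0).
near=> h.
have h_max : forall y', score y' h <= score y h by near: h; exact: score_near.
have maxE : max_score mu l (h.1 + w) (h.2 + e) z = score y h.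
  apply/le_anti; rewrite [X in _ && X]le_bigmax andbT.
  by apply/bigmax_leP; split=> [|y' _]; exact: h_max.
rewrite maxE /score max_scoreE /max_score_diff labelE /perturbed_score deriveE//.
(* For a fixed label the score is affine in [eps], so the loss terms cancel and only the remainder
   of [mu] is left. *)
rewrite [X in `|X|](_ : _ = mu (h.1 + w) z.1 y - mu w z.1 y -
  'd (fun v => mu v z.1 y) w h.1); last by ring.
apply: (@le_trans _ _ (eta * `|h.1|)).
  by near: h; exact: mu_o.
by rewrite ler_pM2l// prod_normE le_max lexx.
Unshelve. all: by end_near. Qed.

End Prediction.

(** * Differentiability of the prediction generating function *)

Theorem theorem1 (R : realType) (d : nat) (dX dY : measure_display)
  (X : measurableType dX) (Y : finMeasurableType dY)
  (Y_discrete : forall A : set Y, measurable A)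
  (D : probability (X * Y)%type R)
  (mu : 'rV[R]_d -> X -> Y -> R) (l : Y -> Y -> R)
  (mu_measurable : forall w yhat, measurable_fun setT (fun x => mu w x yhat))
  (mu_smooth : forall x yhat, smooth (fun w => mu w x yhat))
  (mu_continuous : forall x yhat, continuous (fun w => mu w x yhat))
  (w : 'rV[R]_d) (eps : R)
  (grad_finite : ('E_D[(fun z => `|grad (fun v => mu v z.1 z.2) w|)%R] < +oo)%E)
  (grad_dominated : exists2 g : X * Y -> R, D.-integrable setT (EFin \o g) &
     \forall w' \near w, forall (z : X * Y) (yhat : Y),
       `|grad (fun v => mu v z.1 yhat) w'| <= g z)
  (G_finite : D.-integrable setT (EFin \o max_score mu l w eps))
  (label_unique : forall (u : 'rV[R]_d) (n : nat), (0 < n)%N ->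
     {ae D, forall z,
        unique_argmax (perturbed_score mu l (w + n%:R^-1 *: u) eps z)}) :
  let G := prediction_generating mu l D in
  [/\ differentiable (fun p : 'rV[R]_d * R => G p.1 p.2) (w, eps),
      derive1 (fun e : R => G w e) eps =
        fine 'E_D[fun z => l z.2 (perturbed_label mu l w eps z)],
      eps = 0 ->
        derive1 (fun e : R => G w e) eps =
          fine 'E_D[fun z => l z.2 (predicted_label mu w z)] &
      grad (fun v => G v eps) w =
        \row_(i < d) fine 'E_D[fun z =>
          grad (fun v => mu v z.1 (perturbed_label mu l w eps z)) w 0 i]].
Proof.
have mu_diff x y v : differentiable (fun v' => mu v' x y) v.
  by have [] := mu_smooth x y 1%N.
have [g g_int grad_le] := grad_dominated.
pose p : 'rV[R]_d * R := (w, eps).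
pose L := \sum_(y : Y) \sum_(y' : Y) `|l y y'|.
have le_L y y' : `|l y y'| <= L.
  rewrite /L (bigD1 y)//= (bigD1 y')//= -addrA lerDl addr_ge0// sumr_ge0// => i _.
  exact: sumr_ge0.
(* The first term controls changes of [w], its factor [d] coming from [derive_le_grad]; the constant
   [L] bounds the loss and controls changes of [eps]. A constant is integrable since [D] is a finite
   measure. *)
pose k (z : X * Y) := d%:R * g z + L.
have k_int : D.-integrable setT (EFin \o k).
  exact: (integrableD measurableT (integrableZl measurableT d%:R g_int)
    (finite_measure_integrable_cst D L measurableT)).
have [r r0 grad_ball] : exists2 r : R, 0 < r &
    forall v, `|v| < r -> forall z y, `|grad (fun v' => mu v' z.1 y) (v + w)| <= g z.
  have /nbhs_normP[r /= r0 r_sub] := grad_le.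
  exists r => // v v_lt z y; apply: r_sub.
  by rewrite /ball_ /= opprD addrCA subrr addr0 normrN.
have le_fst (h : 'rV[R]_d * R) : `|h.1| <= `|h| by rewrite prod_normE le_max lexx.
have le_snd (h : 'rV[R]_d * R) : `|h.2| <= `|h|.
  by rewrite prod_normE le_max lexx orbT.
have F_lip : \forall h \near (0 : 'rV[R]_d * R), forall z,
    `|max_score mu l (h + p).1 (h + p).2 z - max_score mu l p.1 p.2 z| <= k z * `|h|.
  apply/nbhs_norm0P; exists r => //= h h_lt z.
  apply: dist_max_score => y; rewrite /perturbed_score /p /=.
  have mu_le : `|mu (h.1 + w) z.1 y - mu w z.1 y| <= d%:R * g z * `|h|.
    apply: le_trans (dist_le_grad (c := g z) (r := r) (mu_diff z.1 y) _ _) _.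
    - by move=> v v_lt; exact: grad_ball.
    - exact: le_lt_trans h_lt.
    - rewrite ler_wpM2l// mulr_ge0//.
      (* [g z] is nonnegative because it bounds the norm of a gradient at [w]. *)
      by apply: le_trans (grad_ball 0 _ z y); rewrite ?normr0.
  rewrite (_ : _ - _ = (mu (h.1 + w) z.1 y - mu w z.1 y) + h.2 * l z.2 y); last by ring.
  apply: le_trans (ler_normD _ _) _; rewrite /k mulrDl lerD// normrM mulrC.
  by rewrite ler_pM.
have A_le h z : `|max_score_diff mu l w eps h z| <= k z * `|h|.
  rewrite /max_score_diff /k mulrDl; apply: le_trans (ler_normD _ _) _.
  rewrite lerD//; last by rewrite normrM mulrC ler_pM.
  apply: le_trans (derive_le_grad _ (mu_diff _ _ _)) _.
  rewrite ler_pM// ler_wpM2l//.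
  by have := grad_ball 0 _ z (perturbed_label mu l w eps z); rewrite normr0 add0r; exact.
have F_diff : {ae D, forall z, forall eta : R, 0 < eta ->
    \forall h \near (0 : 'rV[R]_d * R),
      `|max_score mu l (h + p).1 (h + p).2 z - max_score mu l p.1 p.2 z -
        max_score_diff mu l w eps h z| <= eta * `|h|}.
  (* The zero direction gives uniqueness of the maximizer at [w] itself. *)
  have := label_unique 0 1%N isT; rewrite scaler0 addr0.
  by apply: filterS => z z_uniq; exact: max_score_diffP.
have [G_diff dGE] := differentiable_Rintegral
  (F := fun q => max_score mu l q.1 q.2) (p := p)
  (fun q => measurable_max_score l Y_discrete mu_measurable q.1 q.2)
  (fun h => measurable_max_score_diff l Y_discrete mu_measurable mu_diff w eps h)
  G_finite k_int (linear_max_score_diff l mu_diff w eps) A_le F_lip F_diff.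
(* The uncurried form makes both partial derivatives directional derivatives of one function at
   [p]. *)
pose G2 (q : 'rV[R]_d * R) := \int[D]_z max_score mu l q.1 q.2 z.
have GE : prediction_generating mu l D = fun v e => G2 (v, e).
  by apply/funext => v; apply/funext => e; rewrite /prediction_generating unlock.
have dG h : 'D_h G2 p = \int[D]_z max_score_diff mu l w eps h z.
  by rewrite deriveE// dGE.
have dG_eps : derive1 (fun e => prediction_generating mu l D w e) eps =
    fine 'E_D[fun z => l z.2 (perturbed_label mu l w eps z)].
  rewrite derive1E GE (derive_snd G2 w eps 1) dG unlock /Rintegral.
  congr fine; apply: eq_integral => z _.
  (* In the direction [(0, 1)] the [mu] term is a derivative along 0, so only the loss remains. *)
  by rewrite /max_score_diff /= derive0 add0r mul1r.
split.
- suff -> : (fun q => prediction_generating mu l D q.1 q.2) = G2 by [].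
  by apply/funext => q; rewrite GE -surjective_pairing.
- exact: dG_eps.
- move=> eps0; rewrite [LHS]dG_eps; congr (fine 'E_D[_]).
  by apply/funext => z; rewrite eps0 perturbed_label0.
- apply/rowP => i; rewrite !mxE GE (derive_fst G2 w eps) dG unlock /Rintegral.
  congr fine; apply: eq_integral => z _.
  by rewrite /max_score_diff /= mul0r addr0 mxE.
Qed.
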